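(* Let $M$ and $N$ be two Lie superalgebras over $\mathbb{K}$ acting compatibly on each other, let $M\otimes N$ be their non-abelian tensor product, and let $[M,N]^M$ (resp. $[M,N]^N$) be the graded ideal of $M$ (resp. $N$) that is the image of the homomorphism $\mu\colon M\otimes N\to M$, $m\otimes n\mapsto-(-1)^{|m||n|}({}^nm)$ (resp. $\nu\colon M\otimes N\to N$, $m\otimes n\mapsto{}^mn$). Then: (i) If $[M,N]^M$ is nilpotent, then $M\otimes N$ and $[M,N]^N$ are nilpotent too. Moreover, writing $\mathrm{cl}$ for the nilpotency class, $\mathrm{cl}([M,N]^M)\le\mathrm{cl}(M\otimes N)\le\mathrm{cl}([M,N]^M)+1$ and $\mathrm{cl}([M,N]^N)\le\mathrm{cl}([M,N]^M)+1$. (ii) If $[M,N]^M$ is solvable, then $M\otimes N$ and $[M,N]^N$ are solvable too. Moreover, writing $\ell$ for the derived length, $\ell([M,N]^M)\le\ell(M\otimes N)\le\ell([M,N]^M)+1$ and $\ell([M,N]^N)\le\ell([M,N]^M)+1$. (iii) If $[M,N]^M$ is Engel, then $M\otimes N$ and $[M,N]^N$ are Engel too. Moreover, if $[M,N]^M$ is $n$-Engel, then $M\otimes N$ and $[M,N]^N$ are $(n+1)$-Engel.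
   Context: $\mathbb{K}$ is a unital commutative ring. A supermodule is a $\mathbb{K}$-module $M=M_{\bar0}\oplus M_{\bar1}$ graded by $\mathbb{Z}_2$; $|m|$ is the degree of a homogeneous element, and elements occurring in formulas with degrees are homogeneous. A linear map is even if it preserves degrees. A Lie superalgebra is a supermodule $M$ with a bilinear bracket, $[M_{\alpha},M_{\beta}]\subseteq M_{\alpha+\beta}$, such that $[x,y]=-(-1)^{|x||y|}[y,x]$ and $[x,[y,z]]=[[x,y],z]+(-1)^{|x||y|}[y,[x,z]]$ for homogeneous $x,y,z$, and $[x,x]=0$ for $x\in M_{\bar0}$. Homomorphisms are even linear maps preserving brackets. An action of a Lie superalgebra $P$ on a Lie superalgebra $M$ is an even bilinear map $P\times M\to M$, $(p,m)\mapsto{}^pm$, with ${}^{[p,p']}m={}^p({}^{p'}m)-(-1)^{|p||p'|}\,{}^{p'}({}^pm)$ and ${}^p[m,m']=[{}^pm,m']+(-1)^{|p||m|}[m,{}^pm']$. Actions of $M$ and $N$ on each other are compatible if ${}^{({}^nm)}n'=-(-1)^{|m||n|}[{}^mn,n']$ and ${}^{({}^mn)}m'=-(-1)^{|m||n|}[{}^nm,m']$ for all homogeneous $m,m'\in M$, $n,n'\in N$. Non-abelian tensor product: for Lie superalgebras $M,N$ acting on each other, $M\otimes N$ is the Lie superalgebra generated by symbols $m\otimes n$ ($m\in M_{\bar0}\cup M_{\bar1}$, $n\in N_{\bar0}\cup N_{\bar1}$), of degree $|m|+|n|$, subject to: (i) $\lambda(m\otimes n)=\lambda m\otimes n=m\otimes\lambda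 n$ for $\lambda\in\mathbb{K}$; (ii) $(m+m')\otimes n=m\otimes n+m'\otimes n$ and $m\otimes(n+n')=m\otimes n+m\otimes n'$ for $m,m'$ (resp. $n,n'$) of the same degree; (iii) $[m,m']\otimes n=m\otimes{}^{m'}n-(-1)^{|m||m'|}(m'\otimes{}^mn)$ and $m\otimes[n,n']=(-1)^{|n'|(|m|+|n|)}({}^{n'}m\otimes n)-(-1)^{|m||n|}({}^nm\otimes n')$; (iv) $[m\otimes n,m'\otimes n']=-(-1)^{|m||n|}({}^nm\otimes{}^{m'}n')$. Nilpotency, nilpotency class, solvability and derived length of Lie superalgebras are defined exactly as for Lie algebras, via the lower central series and the derived series. A Lie superalgebra $L$ is $n$-Engel if $\operatorname{ad}(x)^n=0$ for all $x\in L$, where $\operatorname{ad}(x)(y)=[x,y]$; it is Engel if it is $n$-Engel for some $n$. *)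

(* Defs.v *)
From HB Require Import structures.
From mathcomp Require Import all_boot all_algebra.
From mathcomp Require Import boolp classical_sets.

Set Implicit Arguments.
Unset Strict Implicit.
Unset Printing Implicit Defensive.
Import GRing.Theory.
Local Open Scope ring_scope.
Local Open Scope classical_set_scope.
Local Open Scope quotient_scope.

Definition submod (K : pzRingType) (V : lmodType K) (A : set V) : Prop :=
  A 0 /\ forall (k : K) (x y : V), A x -> A y -> A (k *: x + y).

Section LinearFunction.
Variables (K : pzRingType) (V W : lmodType K) (f : V -> W).
Hypothesis fl : linear f.

Lemma lin0 : f 0 = 0.
Proof.
by have := fl (-1) 0 0; rewrite !scaleN1r !addNr.
Qed.

Lemma linD x y : f (x + y) = f x + f y.
Proof. by rewrite -[x in LHS]scale1r fl scale1r. Qed.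

Lemma linZ k x : f (k *: x) = k *: f x.
Proof. by rewrite -[k *: x]addr0 fl lin0 addr0. Qed.

Lemma linN x : f (- x) = - f x.
Proof. by rewrite -scaleN1r linZ scaleN1r. Qed.

End LinearFunction.

(* Z_2 is bool, with sum (+); degrees occurring in exponents are coerced to   *)
(* nat. The element 0 is homogeneous of both degrees.                         *)
HB.mixin Record Lmodule_isSupermodule (K : comPzRingType) V
    of GRing.Lmodule K V := {
  grade : bool -> set V;
  grade_submod : forall a, submod (grade a);
  grade_decomp : forall x : V, exists x0 x1 : V,
    [/\ grade false x0, grade true x1 & x = x0 + x1];
  grade_indep : forall x : V, grade false x -> grade true x -> x = 0
}.
#[short(type="supermodType")]
HB.structure Definition Supermodule (K : comPzRingType) :=
  {V of GRing.Lmodule K V & Lmodule_isSupermodule K V}.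

HB.mixin Record Supermodule_isLieSuperalgebra (K : comPzRingType) L
    of Supermodule K L := {
  br : L -> L -> L;
  br_linearl : forall y, linear (br^~ y);
  br_linearr : forall x, linear (br x);
  br_grade : forall (a b : bool) (x y : L),
    grade a x -> grade b y -> grade (a (+) b) (br x y);
  br_skew : forall (a b : bool) (x y : L), grade a x -> grade b y ->
    br x y = - ((-1) ^+ (a * b)%N *: br y x);
  br_jacobi : forall (a b c : bool) (x y z : L),
    grade a x -> grade b y -> grade c z ->
    br x (br y z) = br (br x y) z + (-1) ^+ (a * b)%N *: br y (br x z);
  br_even_sq : forall x : L, grade false x -> br x x = 0
}.
#[short(type="lieSuperalgType")]
HB.structure Definition LieSuperalgebra (K : comPzRingType) :=
  {L of Supermodule K L & Supermodule_isLieSuperalgebra K L}.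

Record super_hom (K : comPzRingType) (L L' : lieSuperalgType K) (f : L -> L') :
    Prop := SuperHom {
  super_hom_linear : linear f;
  super_hom_even : forall (a : bool) (x : L), grade a x -> grade a (f x);
  super_hom_br : forall x y : L, f (br x y) = br (f x) (f y)
}.

Record super_action (K : comPzRingType) (P M : lieSuperalgType K) :=
    SuperAction {
  act :> P -> M -> M;
  act_linearl : forall m, linear (act^~ m);
  act_linearr : forall p, linear (act p);
  act_grade : forall (a b : bool) (p : P) (m : M),
    grade a p -> grade b m -> grade (a (+) b) (act p m);
  act_br : forall (a b c : bool) (p p' : P) (m : M),
    grade a p -> grade b p' -> grade c m ->
    act (br p p') m =
      act p (act p' m) - (-1) ^+ (a * b)%N *: act p' (act p m);
  act_der : forall (a b c : bool) (p : P) (m m' : M),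
    grade a p -> grade b m -> grade c m' ->
    act p (br m m') =
      br (act p m) m' + (-1) ^+ (a * b)%N *: br m (act p m')
}.

Definition compatible (K : comPzRingType) (M N : lieSuperalgType K)
    (aMN : super_action M N) (aNM : super_action N M) : Prop :=
  forall (a a' b b' : bool) (m m' : M) (n n' : N),
    grade a m -> grade a' m' -> grade b n -> grade b' n' ->
    aMN (aNM n m) n' = - ((-1) ^+ (a * b)%N *: br (aMN m n) n') /\
    aNM (aMN m n) m' = - ((-1) ^+ (a * b)%N *: br (aNM n m) m').

Section Presentation.
Variables (K : comPzRingType) (X : Type) (d : X -> bool).

Inductive lsexpr : Type :=
| EGen of X
| EZero
| EAdd of lsexpr & lsexpr
| EOpp of lsexpr
| EScale of K & lsexpr
| EBr of lsexpr & lsexpr.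

Inductive edeg : bool -> lsexpr -> Prop :=
| edeg_gen x : edeg (d x) (EGen x)
| edeg_zero a : edeg a EZero
| edeg_add a s t : edeg a s -> edeg a t -> edeg a (EAdd s t)
| edeg_opp a s : edeg a s -> edeg a (EOpp s)
| edeg_scale a k s : edeg a s -> edeg a (EScale k s)
| edeg_br a b s t : edeg a s -> edeg b t -> edeg (a (+) b) (EBr s t).

Variable rel : lsexpr -> lsexpr -> Prop.

(* The least congruence for which the quotient is a Lie superalgebra where    *)
(* the relations rel hold. Relations between expressions that are not         *)
(* homogeneous of a common degree are ignored, so that the quotient is graded *)
(* whatever rel is.                                                           *)
Inductive econg : lsexpr -> lsexpr -> Prop :=
| econg_refl s : econg s s
| econg_sym s t : econg s t -> econg t s
| econg_trans s t u : econg s t -> econg t u -> econg s u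
| econg_add s s' t t' :
    econg s s' -> econg t t' -> econg (EAdd s t) (EAdd s' t')
| econg_opp s s' : econg s s' -> econg (EOpp s) (EOpp s')
| econg_scale k s s' : econg s s' -> econg (EScale k s) (EScale k s')
| econg_br s s' t t' :
    econg s s' -> econg t t' -> econg (EBr s t) (EBr s' t')
| econg_addA s t u : econg (EAdd s (EAdd t u)) (EAdd (EAdd s t) u)
| econg_addC s t : econg (EAdd s t) (EAdd t s)
| econg_add0 s : econg (EAdd EZero s) s
| econg_addN s : econg (EAdd (EOpp s) s) EZero
| econg_scaleA k l s : econg (EScale k (EScale l s)) (EScale (k * l) s)
| econg_scale1 s : econg (EScale 1 s) s
| econg_scaleDr k s t :
    econg (EScale k (EAdd s t)) (EAdd (EScale k s) (EScale k t))
| econg_scaleDl k l s :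
    econg (EScale (k + l) s) (EAdd (EScale k s) (EScale l s))
| econg_brDl s t u : econg (EBr (EAdd s t) u) (EAdd (EBr s u) (EBr t u))
| econg_brDr s t u : econg (EBr s (EAdd t u)) (EAdd (EBr s t) (EBr s u))
| econg_brZl k s t : econg (EBr (EScale k s) t) (EScale k (EBr s t))
| econg_brZr k s t : econg (EBr s (EScale k t)) (EScale k (EBr s t))
| econg_skew a b s t : edeg a s -> edeg b t ->
    econg (EBr s t) (EOpp (EScale ((-1) ^+ (a * b)%N) (EBr t s)))
| econg_jacobi a b c s t u : edeg a s -> edeg b t -> edeg c u ->
    econg (EBr s (EBr t u))
          (EAdd (EBr (EBr s t) u)
                (EScale ((-1) ^+ (a * b)%N) (EBr t (EBr s u))))
| econg_even_sq s : edeg false s -> econg (EBr s s) EZero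
| econg_rel a s t : edeg a s -> edeg a t -> rel s t -> econg s t.

HB.instance Definition _ := gen_eqMixin lsexpr.
HB.instance Definition _ := gen_choiceMixin lsexpr.

Definition econgb (s t : lsexpr) : bool := `[< econg s t >].

Lemma econgb_refl : reflexive econgb.
Proof. by move=> s; apply/asboolP/econg_refl. Qed.

Lemma econgb_sym : symmetric econgb.
Proof.
by move=> s t; apply/asboolP/asboolP; exact: econg_sym.
Qed.

Lemma econgb_trans : transitive econgb.
Proof.
by move=> t s u /asboolP st /asboolP tu; apply/asboolP/(econg_trans st).
Qed.

Canonical econg_equiv := EquivRel econgb econgb_refl econgb_sym econgb_trans.

Definition presented : Type := {eq_quot econg_equiv}.
HB.instance Definition _ := Choice.on presented.

Definition epi (s : lsexpr) : presented := \pi_({eq_quot econg_equiv}) s.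

Definition erepr (x : presented) : lsexpr := repr (x : {eq_quot econg_equiv}).

Lemma ereprK : cancel erepr epi. Proof. exact: reprK. Qed.

Lemma epiP (s t : lsexpr) : epi s = epi t <-> econg s t.
Proof.
split=> [/eqmodP/asboolP //|st]; exact/eqmodP/asboolP.
Qed.

Lemma erepr_epi (s : lsexpr) : econg (erepr (epi s)) s.
Proof. by apply/epiP; rewrite ereprK. Qed.

Definition padd (x y : presented) := epi (EAdd (erepr x) (erepr y)).
Definition popp (x : presented) := epi (EOpp (erepr x)).
Definition pscale (k : K) (x : presented) := epi (EScale k (erepr x)).
Definition pbr (x y : presented) := epi (EBr (erepr x) (erepr y)).

Lemma epi_add s t : epi (EAdd s t) = padd (epi s) (epi t).
Proof. by apply/epiP/econg_sym/econg_add; exact: erepr_epi. Qed.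
Lemma epi_opp s : epi (EOpp s) = popp (epi s).
Proof. by apply/epiP/econg_sym/econg_opp; exact: erepr_epi. Qed.
Lemma epi_scale k s : epi (EScale k s) = pscale k (epi s).
Proof. by apply/epiP/econg_sym/econg_scale; exact: erepr_epi. Qed.
Lemma epi_br s t : epi (EBr s t) = pbr (epi s) (epi t).
Proof. by apply/epiP/econg_sym/econg_br; exact: erepr_epi. Qed.

Let epiE := (epi_add, epi_opp, epi_scale, epi_br).

Lemma epi_surj (x : presented) : exists s, x = epi s.
Proof. by exists (erepr x); rewrite ereprK. Qed.

Lemma paddA : associative padd.
Proof.
move=> x y z; have [s ->] := epi_surj x; have [t ->] := epi_surj y.
have [u ->] := epi_surj z; rewrite -!epiE; exact/epiP/econg_addA.
Qed.
Lemma paddC : commutative padd.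
Proof.
move=> x y; have [s ->] := epi_surj x; have [t ->] := epi_surj y.
rewrite -!epiE; exact/epiP/econg_addC.
Qed.
Lemma padd0 : left_id (epi EZero) padd.
Proof.
by move=> x; have [s ->] := epi_surj x; rewrite -!epiE; exact/epiP/econg_add0.
Qed.
Lemma paddN : left_inverse (epi EZero) popp padd.
Proof.
by move=> x; have [s ->] := epi_surj x; rewrite -!epiE; exact/epiP/econg_addN.
Qed.
HB.instance Definition _ :=
  GRing.isZmodule.Build presented paddA paddC padd0 paddN.

Lemma pscaleA k l x : pscale k (pscale l x) = pscale (k * l) x.
Proof.
by have [s ->] := epi_surj x; rewrite -!epiE; exact/epiP/econg_scaleA.
Qed.
Lemma pscale1 : left_id 1 pscale.
Proof.
by move=> x; have [s ->] := epi_surj x; rewrite -!epiE; exact/epiP/econg_scale1.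
Qed.
Lemma pscaleDr : right_distributive pscale +%R.
Proof.
move=> k x y; have [s ->] := epi_surj x; have [t ->] := epi_surj y.
rewrite -[RHS]/(padd _ _) -[_ + _]/(padd _ _) -!epiE.
exact/epiP/econg_scaleDr.
Qed.
Lemma pscaleDl x : {morph pscale^~ x : k l / k + l}.
Proof.
move=> k l; have [s ->] := epi_surj x.
rewrite -[RHS]/(padd _ _) -!epiE; exact/epiP/econg_scaleDl.
Qed.
HB.instance Definition _ :=
  GRing.Zmodule_isLmodule.Build K presented pscaleA pscale1 pscaleDr pscaleDl.

Lemma epi0E : epi EZero = 0. Proof. by []. Qed.
Lemma epiDE s t : epi (EAdd s t) = epi s + epi t. Proof. exact: epi_add. Qed.
Lemma epiNE s : epi (EOpp s) = - epi s. Proof. exact: epi_opp. Qed.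
Lemma epiZE k s : epi (EScale k s) = k *: epi s. Proof. exact: epi_scale. Qed.

Lemma pbr_linearl y : linear (pbr^~ y).
Proof.
move=> k x x'; have [s ->] := epi_surj x; have [s' ->] := epi_surj x'.
have [t ->] := epi_surj y; rewrite /= -epiZE -epiDE -!epi_br -epiZE -epiDE.
apply/epiP; apply: (econg_trans (econg_brDl _ _ _)).
by apply: econg_add; [exact: econg_brZl|exact: econg_refl].
Qed.
Lemma pbr_linearr x : linear (pbr x).
Proof.
move=> k y y'; have [s ->] := epi_surj y; have [s' ->] := epi_surj y'.
have [t ->] := epi_surj x; rewrite /= -epiZE -epiDE -!epi_br -epiZE -epiDE.
apply/epiP; apply: (econg_trans (econg_brDr _ _ _)).
by apply: econg_add; [exact: econg_brZr|exact: econg_refl].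
Qed.

Let pbr0l y : pbr 0 y = 0. Proof. exact: lin0 (pbr_linearl y). Qed.
Let pbr0r x : pbr x 0 = 0. Proof. exact: lin0 (pbr_linearr x). Qed.
Let pbrDl x x' y : pbr (x + x') y = pbr x y + pbr x' y.
Proof. exact: linD (pbr_linearl y) _ _. Qed.
Let pbrDr x y y' : pbr x (y + y') = pbr x y + pbr x y'.
Proof. exact: linD (pbr_linearr x) _ _. Qed.
Let pbrZl k x y : pbr (k *: x) y = k *: pbr x y.
Proof. exact: linZ (pbr_linearl y) _ _. Qed.
Let pbrZr k x y : pbr x (k *: y) = k *: pbr x y.
Proof. exact: linZ (pbr_linearr x) _ _. Qed.

Definition pgrade (a : bool) : set presented :=
  [set x | exists2 s, edeg a s & x = epi s].

Lemma pgrade_submod a : submod (pgrade a).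
Proof.
split; first by exists EZero => //; exact: edeg_zero.
move=> k _ _ [s hs ->] [t ht ->]; exists (EAdd (EScale k s) t).
  by apply: edeg_add => //; exact: edeg_scale.
by rewrite epiDE epiZE.
Qed.

Fixpoint eproj (a : bool) (s : lsexpr) : presented :=
  match s with
  | EGen x => if d x == a then epi (EGen x) else 0
  | EZero => 0
  | EAdd s t => eproj a s + eproj a t
  | EOpp s => - eproj a s
  | EScale k s => k *: eproj a s
  | EBr s t => pbr (eproj false s) (eproj a t) + pbr (eproj true s) (eproj (~~ a) t)
  end.

Lemma eproj_deg a b s : edeg a s -> eproj b s = if a == b then epi s else 0.
Proof.
move=> hs; elim: hs b => {a s} /=.
- by [].
- by move=> a b; case: ifP.
- by move=> a s t _ IHs _ IHt b; rewrite IHs IHt epiDE; case: ifP; rewrite ?addr0.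
- by move=> a s _ IHs b; rewrite IHs epiNE; case: ifP; rewrite ?oppr0.
- by move=> a k s _ IHs b; rewrite IHs epiZE; case: ifP; rewrite ?scaler0.
- move=> a a' s t _ IHs _ IHt b; rewrite !IHs !IHt epi_br.
  by case: a a' b {IHs IHt} => [] [] []; rewrite /= ?pbr0l ?pbr0r ?addr0 ?add0r.
Qed.

Lemma eproj_sum s : epi s = eproj false s + eproj true s.
Proof.
elim: s => /= [x||s IHs t IHt|s IHs|k s IHs|s IHs t IHt].
- by case: (d x); rewrite ?addr0 ?add0r.
- by rewrite addr0.
- by rewrite epiDE IHs IHt addrACA.
- by rewrite epiNE IHs opprD.
- by rewrite epiZE IHs scalerDr.
- rewrite epi_br IHs IHt pbrDr !pbrDl.
  by rewrite -!addrA; congr (_ + _); rewrite addrC -addrA addrCA.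
Qed.

Lemma eproj_grade a s : pgrade a (eproj a s).
Proof.
have [p0 pD] := pgrade_submod a.
have pA c x y : pgrade c x -> pgrade c y -> pgrade c (x + y).
  by have [_ h] := pgrade_submod c; move=> ? ?; rewrite -[x]scale1r; exact: h.
have pZ c k x : pgrade c x -> pgrade c (k *: x).
  have [h0 h] := pgrade_submod c.
  by move=> ?; rewrite -[_ *: _]addr0; exact: h.
have pB c c' x y : pgrade c x -> pgrade c' y -> pgrade (c (+) c') (pbr x y).
  move=> [u hu ->] [v hv ->]; exists (EBr u v); first exact: edeg_br.
  by rewrite epi_br.
elim: s a {p0 pD} => /= [x a|a|s IHs t IHt a|s IHs a|k s IHs a|s IHs t IHt a].
- case: eqP => [<-|_]; first by exists (EGen x) => //; exact: edeg_gen.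
  by case: (pgrade_submod a).
- by case: (pgrade_submod a).
- exact: pA.
- by rewrite -scaleN1r; exact: pZ.
- exact: pZ.
- apply: pA; first by rewrite -[a]addFb; exact: pB.
  by rewrite -[X in pgrade X]negbK -addTb; exact: pB.
Qed.

Lemma eproj_homog a b s t :
  edeg b s -> edeg b t -> econg s t -> eproj a s = eproj a t.
Proof.
by move=> hs ht /epiP st; rewrite (eproj_deg _ hs) (eproj_deg _ ht) st.
Qed.

Lemma eproj_cong a s t : econg s t -> eproj a s = eproj a t.
Proof.
move=> st; elim: st a => {s t}.
- by [].
- by move=> s t _ IH a; rewrite IH.
- by move=> s t u _ IH1 _ IH2 a; rewrite IH1.
- by move=> s s' t t' _ IH1 _ IH2 a /=; rewrite IH1 IH2.
- by move=> s s' _ IH a /=; rewrite IH.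
- by move=> k s s' _ IH a /=; rewrite IH.
- by move=> s s' t t' _ IH1 _ IH2 a /=; rewrite !IH1 !IH2.
- by move=> * /=; rewrite addrA.
- by move=> * /=; rewrite addrC.
- by move=> * /=; rewrite add0r.
- by move=> * /=; rewrite addNr.
- by move=> * /=; rewrite scalerA.
- by move=> * /=; rewrite scale1r.
- by move=> * /=; rewrite scalerDr.
- by move=> * /=; rewrite scalerDl.
- by move=> * /=; rewrite !pbrDl addrACA.
- by move=> * /=; rewrite !pbrDr addrACA.
- by move=> * /=; rewrite !pbrZl scalerDr.
- by move=> * /=; rewrite !pbrZr scalerDr.
- move=> b c s t hs ht a.
  apply: (@eproj_homog a (b (+) c)); [exact: edeg_br| |exact: econg_skew].
  by apply: edeg_opp; apply: edeg_scale; rewrite addbC; exact: edeg_br.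
- move=> b c e s t u hs ht hu a.
  apply: (@eproj_homog a (b (+) (c (+) e)));
    [by do !apply: edeg_br| |exact: econg_jacobi hs ht hu].
  apply: edeg_add; first by rewrite addbA; do !apply: edeg_br.
  by apply: edeg_scale; rewrite addbCA; do !apply: edeg_br.
- move=> s hs a; apply: (@eproj_homog a (false (+) false)).
  + exact: edeg_br.
  + exact: edeg_zero.
  + exact: econg_even_sq.
- by move=> b s t hs ht r a; apply: (eproj_homog a hs ht); exact: econg_rel hs ht r.
Qed.

Lemma pgrade_decomp (x : presented) : exists x0 x1 : presented,
  [/\ pgrade false x0, pgrade true x1 & x = x0 + x1].
Proof.
have [s ->] := epi_surj x; exists (eproj false s), (eproj true s).
by split; [exact: eproj_grade|exact: eproj_grade|exact: eproj_sum].
Qed.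

Lemma pgrade_indep (x : presented) : pgrade false x -> pgrade true x -> x = 0.
Proof.
move=> [s hs ->] [t ht st].
have /(eproj_cong false) : econg s t by exact/epiP.
by rewrite (eproj_deg _ hs) (eproj_deg _ ht).
Qed.
HB.instance Definition _ := Lmodule_isSupermodule.Build K presented
  pgrade_submod pgrade_decomp pgrade_indep.

Lemma pbr_grade (a b : bool) (x y : presented) :
  pgrade a x -> pgrade b y -> pgrade (a (+) b) (pbr x y).
Proof.
move=> [s hs ->] [t ht ->]; exists (EBr s t); first exact: edeg_br.
by rewrite epi_br.
Qed.
Lemma pbr_skew (a b : bool) (x y : presented) : pgrade a x -> pgrade b y ->
  pbr x y = - ((-1) ^+ (a * b)%N *: pbr y x).
Proof.
move=> [s hs ->] [t ht ->]; rewrite -!epi_br -epiZE -epiNE.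
exact/epiP/econg_skew.
Qed.
Lemma pbr_jacobi (a b c : bool) (x y z : presented) :
  pgrade a x -> pgrade b y -> pgrade c z ->
  pbr x (pbr y z) = pbr (pbr x y) z + (-1) ^+ (a * b)%N *: pbr y (pbr x z).
Proof.
move=> [s hs ->] [t ht ->] [u hu ->]; rewrite -!epi_br -epiZE -epiDE.
exact/epiP/(econg_jacobi hs ht hu).
Qed.
Lemma pbr_even_sq (x : presented) : pgrade false x -> pbr x x = 0.
Proof. by move=> [s hs ->]; rewrite -!epi_br; exact/epiP/econg_even_sq. Qed.
HB.instance Definition _ := Supermodule_isLieSuperalgebra.Build K presented
  pbr_linearl pbr_linearr pbr_grade pbr_skew pbr_jacobi pbr_even_sq.

Fixpoint eeval (L : lieSuperalgType K) (f : X -> L) (s : lsexpr) : L :=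
  match s with
  | EGen x => f x
  | EZero => 0
  | EAdd s t => eeval f s + eeval f t
  | EOpp s => - eeval f s
  | EScale k s => k *: eeval f s
  | EBr s t => br (eeval f s) (eeval f t)
  end.

(* This is the homomorphism extending f when f respects degrees and the       *)
(* relations, see plift_hom, plift_gen and plift_uniq.                        *)
Definition plift (L : lieSuperalgType K) (f : X -> L) (x : presented) : L :=
  eeval f (erepr x).

Section Universal.
Variables (L : lieSuperalgType K) (f : X -> L).

Hypothesis f_grade : forall x, grade (d x) (f x).
Hypothesis f_rel : forall s t, rel s t -> eeval f s = eeval f t.

Lemma eeval_grade a s : edeg a s -> grade a (eeval f s).
Proof.
have gA c (x y : L) : grade c x -> grade c y -> grade c (x + y).
  by have [_ h] := grade_submod (s := L) c; move=> ? ?; rewrite -[x]scale1r; exact: h.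
have gZ c k (x : L) : grade c x -> grade c (k *: x).
  have [h0 h] := grade_submod (s := L) c.
  by move=> ?; rewrite -[_ *: _]addr0; exact: h.
elim=> {a s} //=.
- by move=> a; case: (grade_submod (s := L) a).
- by move=> *; exact: gA.
- by move=> *; rewrite -scaleN1r; exact: gZ.
- by move=> *; exact: gZ.
- by move=> *; exact: br_grade.
Qed.

Lemma eeval_cong s t : econg s t -> eeval f s = eeval f t.
Proof.
elim=> {s t} //=.
- by move=> s t u _ -> _ ->.
- by move=> s s' t t' _ -> _ ->.
- by move=> s s' _ ->.
- by move=> k s s' _ ->.
- by move=> s s' t t' _ -> _ ->.
- by move=> *; rewrite addrA.
- by move=> *; rewrite addrC.
- by move=> *; rewrite add0r.
- by move=> *; rewrite addNr.
- by move=> *; rewrite scalerA.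
- by move=> *; rewrite scale1r.
- by move=> *; rewrite scalerDr.
- by move=> *; rewrite scalerDl.
- by move=> *; rewrite (linD (br_linearl _)).
- by move=> *; rewrite (linD (br_linearr _)).
- by move=> *; rewrite (linZ (br_linearl _)).
- by move=> *; rewrite (linZ (br_linearr _)).
- by move=> a b s t /eeval_grade hs /eeval_grade ht; exact: br_skew.
- move=> a b c s t u /eeval_grade hs /eeval_grade ht /eeval_grade hu.
  exact: br_jacobi hs ht hu.
- by move=> s /eeval_grade; exact: br_even_sq.
- by move=> a s t _ _; exact: f_rel.
Qed.

Lemma plift_epi s : plift f (epi s) = eeval f s.
Proof. exact/eeval_cong/erepr_epi. Qed.

Lemma plift_gen x : plift f (epi (EGen x)) = f x.
Proof. exact: plift_epi. Qed.

Lemma plift_hom : super_hom (plift f).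
Proof.
split=> [k x y|a _ [s hs ->]|x y].
- have [s ->] := epi_surj x; have [t ->] := epi_surj y.
  by rewrite -epiZE -epiDE !plift_epi.
- by rewrite plift_epi; exact: eeval_grade.
- have [s ->] := epi_surj x; have [t ->] := epi_surj y.
  by rewrite -[br _ _]/(pbr _ _) -epi_br !plift_epi.
Qed.

Lemma plift_uniq (g : presented -> L) :
  super_hom g -> (forall x, g (epi (EGen x)) = f x) -> g =1 plift f.
Proof.
move=> [gl _ gb] gf x; have [s ->] := epi_surj x; rewrite plift_epi.
elim: s => /= [y||s IHs t IHt|s IHs|k s IHs|s IHs t IHt].
- exact: gf.
- exact: lin0 gl.
- by rewrite epiDE (linD gl) IHs IHt.
- by rewrite epiNE (linN gl) IHs.
- by rewrite epiZE (linZ gl) IHs.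
- by rewrite epi_br -[pbr _ _]/(br _ _) gb IHs IHt.
Qed.

End Universal.

End Presentation.

Arguments EZero {K X}.

Section Tensor.
Variables (K : comPzRingType) (M N : lieSuperalgType K).
Variables (aMN : super_action M N) (aNM : super_action N M).

Record tsym : Type := TSym {
  tsym_dl : bool; tsym_dr : bool; tsym_l : M; tsym_r : N;
  tsym_hl : grade tsym_dl tsym_l;
  tsym_hr : grade tsym_dr tsym_r
}.

Definition tsym_deg (x : tsym) : bool := tsym_dl x (+) tsym_dr x.

(* The proofs of homogeneity of elements such as [m, m'] are universally      *)
(* quantified; they exist by br_grade, act_grade and grade_submod.            *)
Inductive tensor_rel : lsexpr K tsym -> lsexpr K tsym -> Prop :=
| tensor_scalel a b m n k (hm : grade a m) (hn : grade b n)
    (hkm : grade a (k *: m)) :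
    tensor_rel (EScale k (EGen K (TSym hm hn))) (EGen K (TSym hkm hn))
| tensor_scaler a b m n k (hm : grade a m) (hn : grade b n)
    (hkn : grade b (k *: n)) :
    tensor_rel (EScale k (EGen K (TSym hm hn))) (EGen K (TSym hm hkn))
| tensor_addl a b m m' n (hm : grade a m) (hm' : grade a m') (hn : grade b n)
    (hmm' : grade a (m + m')) :
    tensor_rel (EGen K (TSym hmm' hn))
      (EAdd (EGen K (TSym hm hn)) (EGen K (TSym hm' hn)))
| tensor_addr a b m n n' (hm : grade a m) (hn : grade b n) (hn' : grade b n')
    (hnn' : grade b (n + n')) :
    tensor_rel (EGen K (TSym hm hnn'))
      (EAdd (EGen K (TSym hm hn)) (EGen K (TSym hm hn')))
| tensor_brl a a' b m m' n
    (hm : grade a m) (hm' : grade a' m') (hn : grade b n)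
    (hmm' : grade (a (+) a') (br m m'))
    (hm'n : grade (a' (+) b) (aMN m' n))
    (hmn : grade (a (+) b) (aMN m n)) :
    tensor_rel (EGen K (TSym hmm' hn))
      (EAdd (EGen K (TSym hm hm'n))
            (EOpp (EScale ((-1) ^+ (a * a')%N) (EGen K (TSym hm' hmn)))))
| tensor_brr a b b' m n n'
    (hm : grade a m) (hn : grade b n) (hn' : grade b' n')
    (hnn' : grade (b (+) b') (br n n'))
    (hn'm : grade (b' (+) a) (aNM n' m))
    (hnm : grade (b (+) a) (aNM n m)) :
    tensor_rel (EGen K (TSym hm hnn'))
      (EAdd (EScale ((-1) ^+ (b' * (a + b))%N) (EGen K (TSym hn'm hn)))
            (EOpp (EScale ((-1) ^+ (a * b)%N) (EGen K (TSym hnm hn')))))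
| tensor_br a a' b b' m m' n n'
    (hm : grade a m) (hm' : grade a' m') (hn : grade b n) (hn' : grade b' n')
    (hnm : grade (b (+) a) (aNM n m))
    (hm'n' : grade (a' (+) b') (aMN m' n')) :
    tensor_rel (EBr (EGen K (TSym hm hn)) (EGen K (TSym hm' hn')))
      (EOpp (EScale ((-1) ^+ (a * b)%N) (EGen K (TSym hnm hm'n')))).

Definition tensor : Type := presented tsym_deg tensor_rel.
HB.instance Definition _ := LieSuperalgebra.on tensor.

Definition tens (a b : bool) (m : M) (n : N) (hm : grade a m) (hn : grade b n) :
    tensor :=
  epi tsym_deg tensor_rel (EGen K (TSym hm hn)).

(* Hence econg_rel discards none of the relations of tensor_rel.              *)
Lemma tensor_rel_deg s t : tensor_rel s t ->
  exists a, edeg tsym_deg a s /\ edeg tsym_deg a t.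
Proof.
have G c a b (m : M) (n : N) (hm : grade a m) (hn : grade b n) :
    c = a (+) b -> edeg tsym_deg c (EGen K (TSym hm hn)).
  by move=> ->; exact: (@edeg_gen K _ tsym_deg (TSym hm hn)).
have B c c' u v e : e = c (+) c' -> edeg tsym_deg c u -> edeg tsym_deg c' v ->
    edeg tsym_deg e (EBr u v).
  by move=> ->; exact: edeg_br.
case=> [a b m n k hm hn hkm|a b m n k hm hn hkn|a b m m' n hm hm' hn hmm'
  |a b m n n' hm hn hn' hnn'|a a' b m m' n hm hm' hn hmm' hm'n hmn
  |a b b' m n n' hm hn hn' hnn' hn'm hnm
  |a a' b b' m m' n n' hm hm' hn hn' hnm hm'n'].
- by exists (a (+) b); split; [apply: edeg_scale|]; exact: G.
- by exists (a (+) b); split; [apply: edeg_scale|]; exact: G.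
- by exists (a (+) b); split; [|apply: edeg_add]; exact: G.
- by exists (a (+) b); split; [|apply: edeg_add]; exact: G.
- exists (a (+) a' (+) b); split; first exact: G.
  apply: edeg_add; [|apply: edeg_opp; apply: edeg_scale]; apply: G.
    by rewrite addbA.
  by rewrite addbA [a' (+) a]addbC.
- exists (a (+) (b (+) b')); split; first exact: G.
  apply: edeg_add; [|apply: edeg_opp]; apply: edeg_scale; apply: G.
    by rewrite addbA addbC addbA.
  by rewrite addbA [b (+) a]addbC.
- exists ((a (+) b) (+) (a' (+) b')); split.
    by apply: B; [reflexivity|apply: G|apply: G].
  by apply: edeg_opp; apply: edeg_scale; apply: G; rewrite [b (+) a]addbC.
Qed.

Definition mu_gen (x : tsym) : M :=
  - ((-1) ^+ (tsym_dl x * tsym_dr x)%N *: aNM (tsym_r x) (tsym_l x)).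

Definition nu_gen (x : tsym) : N := aMN (tsym_l x) (tsym_r x).

Definition mu : tensor -> M := plift mu_gen.

Definition nu : tensor -> N := plift nu_gen.

Section Compatible.
Hypothesis hc : compatible aMN aNM.

Local Ltac sgn := rewrite /=
  ?(mul0n, mul1n, muln0, muln1, add0n, addn0, exprD, expr0, expr1, mulrNN,
    mulr1, mul1r, scaleN1r, scale1r, opprK, scalerN, scaleNr)
  ?opprD ?opprK //.

Lemma mu_gen_grade x : grade (tsym_deg x) (mu_gen x).
Proof.
case: x => a b m n hm hn; rewrite /tsym_deg /mu_gen /= addbC -scaleNr.
have [g0 gZ] := grade_submod (s := M) (b (+) a).
by rewrite -[_ *: _]addr0; apply: gZ => //; exact: act_grade.
Qed.

Lemma nu_gen_grade x : grade (tsym_deg x) (nu_gen x).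
Proof. by case: x => a b m n hm hn; exact: act_grade. Qed.

Lemma mu_gen_rel s t : tensor_rel s t -> eeval mu_gen s = eeval mu_gen t.
Proof.
case=> [a b m n k hm hn hkm|a b m n k hm hn hkn|a b m m' n hm hm' hn hmm'
  |a b m n n' hm hn hn' hnn'|a a' b m m' n hm hm' hn hmm' hm'n hmn
  |a b b' m n n' hm hn hn' hnn' hn'm hnm
  |a a' b b' m m' n n' hm hm' hn hn' hnm hm'n']; rewrite /= /mu_gen /=.
- by rewrite (linZ (act_linearr aNM _)) scalerN !scalerA mulrC.
- by rewrite (linZ (act_linearl aNM _)) scalerN !scalerA mulrC.
- by rewrite (linD (act_linearr aNM _)) scalerDr opprD.
- by rewrite (linD (act_linearl aNM _)) scalerDr opprD.
- have [_ e1] := hc hm' hm hn hn; have [_ e2] := hc hm hm' hn hn.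
  rewrite e1 e2 (act_der aNM hn hm hm').
  rewrite (br_skew _ _ _ _ (act_grade aNM hn hm') hm) (br_skew _ _ _ _ (act_grade aNM hn hm) hm').
  by case: a a' b {hm hm' hn hmm' hm'n hmn e1 e2} => [] [] [];
    sgn; rewrite addrC.
- rewrite (act_br aNM hn hn' hm).
  by case: a b b' {hm hn hn' hnn' hn'm hnm} => [] [] [];
    sgn; rewrite addrC.
- have [_ e] := hc hm' hnm hn' hn'.
  rewrite e (linN (br_linearl _)) (linZ (br_linearl _)) (linN (br_linearr _)).
  rewrite (linZ (br_linearr _)) (br_skew _ _ _ _ (act_grade aNM hn' hm') hnm).
  by case: a a' b b' {hm hm' hn hn' hnm hm'n' e} => [] [] [] [];
    sgn.
Qed.

Lemma nu_gen_rel s t : tensor_rel s t -> eeval nu_gen s = eeval nu_gen t.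
Proof.
case=> [a b m n k hm hn hkm|a b m n k hm hn hkn|a b m m' n hm hm' hn hmm'
  |a b m n n' hm hn hn' hnn'|a a' b m m' n hm hm' hn hmm' hm'n hmn
  |a b b' m n n' hm hn hn' hnn' hn'm hnm
  |a a' b b' m m' n n' hm hm' hn hn' hnm hm'n']; rewrite /= /nu_gen /=.
- by rewrite (linZ (act_linearl aMN _)).
- by rewrite (linZ (act_linearr aMN _)).
- by rewrite (linD (act_linearl aMN _)).
- by rewrite (linD (act_linearr aMN _)).
- exact: act_br hm hm' hn.
- have [e1 _] := hc hm hm hn' hn; have [e2 _] := hc hm hm hn hn'.
  rewrite e1 e2 (act_der aMN hm hn hn') (br_skew _ _ _ _ (act_grade aMN hm hn') hn).
  by case: a b b' {hm hn hn' hnn' hn'm hnm e1 e2} => [] [] [];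
    sgn; rewrite addrC.
- have [e _] := hc hm hm hn (act_grade aMN hm' hn').
  by rewrite e; case: a b {hm hn hnm e} => [] []; sgn.
Qed.

Lemma mu_hom : super_hom mu.
Proof. exact: plift_hom mu_gen_grade mu_gen_rel. Qed.

Lemma mu_tens (a b : bool) (m : M) (n : N) (hm : grade a m) (hn : grade b n) :
  mu (tens hm hn) = - ((-1) ^+ (a * b)%N *: aNM n m).
Proof. exact: plift_gen mu_gen_grade mu_gen_rel _. Qed.

Lemma nu_hom : super_hom nu.
Proof. exact: plift_hom nu_gen_grade nu_gen_rel. Qed.

Lemma nu_tens (a b : bool) (m : M) (n : N) (hm : grade a m) (hn : grade b n) :
  nu (tens hm hn) = aMN m n.
Proof. exact: plift_gen nu_gen_grade nu_gen_rel _. Qed.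

End Compatible.

End Tensor.

Arguments mu {K M N} aMN aNM x.
Arguments nu {K M N} aMN aNM x.

(* The notions below concern a graded subalgebra A of L; for L itself, A is   *)
(* setT. The series are those of A, since brackets and spans computed in A    *)
(* and in L agree.                                                            *)
Section Series.
Variables (K : comPzRingType) (L : lieSuperalgType K).
Implicit Types A B : set L.

Definition brs A B : set L :=
  smallest (@submod K L) [set br x y | x in A & y in B].

Fixpoint lower_central A (n : nat) : set L :=
  if n is n'.+1 then brs (lower_central A n') A else A.

Fixpoint derived A (n : nat) : set L :=
  if n is n'.+1 then brs (derived A n') (derived A n') else A.

Definition nilpotent A : Prop := exists n, lower_central A n = [set 0].

Definition solvable A : Prop := exists n, derived A n = [set 0].

(* junk value 0 if A is not nilpotent (resp. not solvable) *)
Definition nil_class A : nat :=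
  xget 0%N [set n | lower_central A n = [set 0] /\
    forall k, lower_central A k = [set 0] -> (n <= k)%N].

Definition derived_length A : nat :=
  xget 0%N [set n | derived A n = [set 0] /\
    forall k, derived A k = [set 0] -> (n <= k)%N].

Definition n_engel (n : nat) A : Prop :=
  forall x y, A x -> A y -> iter n (br x) y = 0.

Definition engel A : Prop := exists n, n_engel n A.

End Series.

(* Main.v *)
(** The tensor product [M (x) N] is spanned by the symbols [m (x) n], so
    relation (iv) says that its bracket factors as [[x, y] = mu x (x) nu y].
    Hence the kernel of [mu] is central: [M (x) N] is a central extension of
    [[M, N]^M], which raises the class, the derived length and the Engel degree
    by at most one, and [[M, N]^N] is a quotient of [M (x) N]. *)

Require Import Defs.
From HB Require Import structures.
From mathcomp Require Import all_boot all_algebra.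
From mathcomp Require Import boolp classical_sets.

Set Implicit Arguments.
Unset Strict Implicit.
Unset Printing Implicit Defensive.
Local Open Scope classical_set_scope.

(** * Closure properties of submodules and of graded pieces *)

Section Submodules.
Import GRing.Theory.
Local Open Scope ring_scope.
Variables (K : pzRingType) (V : lmodType K) (A : set V).
Hypothesis sA : submod A.

Lemma submod0 : A 0. Proof. by case: sA. Qed.

Lemma submodD x y : A x -> A y -> A (x + y).
Proof. by rewrite -[x in x + y]scale1r; case: sA => _; apply. Qed.

Lemma submodZ k x : A x -> A (k *: x).
Proof. by move=> Ax; rewrite -[_ *: _]addr0; apply: sA.2 => //; exact: submod0. Qed.

Lemma submodN x : A x -> A (- x).
Proof. by rewrite -scaleN1r; exact: submodZ. Qed.

End Submodules.

Section Grading.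
Import GRing.Theory.
Local Open Scope ring_scope.
Variables (K : comPzRingType) (V : supermodType K).

Lemma grade0 a : grade a (0 : V).
Proof. by apply: submod0; exact: grade_submod. Qed.

Lemma gradeD a (x y : V) : grade a x -> grade a y -> grade a (x + y).
Proof. by apply: submodD; exact: grade_submod. Qed.

Lemma gradeZ a k (x : V) : grade a x -> grade a (k *: x).
Proof. by apply: submodZ; exact: grade_submod. Qed.

Lemma gradeN a (x : V) : grade a x -> grade a (- x).
Proof. by apply: submodN; exact: grade_submod. Qed.

End Grading.

(** * Spans and linear maps *)

Section Span.
Import GRing.Theory.
Local Open Scope ring_scope.

Lemma submod_smallest (K : pzRingType) (V : lmodType K) (G : set V) :
  submod (smallest (@submod K V) G).
Proof.
split=> [B [sB _]|k x y Ax Ay B [sB GB]]; first exact: submod0.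
by apply: sB.2; [exact: Ax|exact: Ay].
Qed.

Variables (K : pzRingType) (V W : lmodType K) (f : V -> W).
Hypothesis fl : linear f.

Lemma submod_preimage (A : set W) : submod A -> submod (f @^-1` A).
Proof.
move=> sA; split=> [|k x y Ax Ay]; rewrite /preimage /=.
  by rewrite (lin0 fl); exact: submod0.
by rewrite fl; exact: sA.2.
Qed.

Lemma submod_image (A : set V) : submod A -> submod (f @` A).
Proof.
move=> sA; split=> [|k _ _ [x Ax <-] [y Ay <-]].
  by exists 0; [exact: submod0|exact: lin0].
by exists (k *: x + y); [exact: sA.2|exact: fl].
Qed.

(** Minimality of the span gives both inclusions: the preimage of the span of [f @]
    G[is a submodule containing]G[, and the image of the span of]G[is a submodule containing]f
    @[G]. *)
Lemma image_smallest_submod (G : set V) :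
  f @` smallest (@submod K V) G = smallest (@submod K W) (f @` G).
Proof.
apply/seteqP; split.
  move=> _ [x Gx <-].
  apply: (Gx (f @^-1` smallest (@submod K W) (f @` G))); split.
    exact/submod_preimage/submod_smallest.
  by move=> y Gy B [_]; apply; exists y.
apply: smallest_sub; first exact/submod_image/submod_smallest.
by apply: image_subset; exact: sub_smallest.
Qed.

End Span.

(** * Homomorphic images and central extensions *)

Section SuperHomomorphism.
Import GRing.Theory.
Local Open Scope ring_scope.
Variables (K : comPzRingType) (L L' : lieSuperalgType K) (f : L -> L').
Hypothesis fh : super_hom f.
Let fl := super_hom_linear fh.

Lemma image_set0 : f @` [set 0] = [set 0].
Proof. by rewrite image_set1 (lin0 fl). Qed.

Lemma image_brs A B : f @` brs A B = brs (f @` A) (f @` B).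
Proof.
rewrite /brs (image_smallest_submod fl); congr smallest; apply/seteqP; split.
  move=> _ [_ [x Ax [y By <-]] <-]; rewrite (super_hom_br fh).
  by exists (f x); [exists x|exists (f y) => //; exists y].
move=> _ [_ [x Ax <-] [_ [y By <-] <-]]; exists (br x y).
  by exists x => //; exists y.
exact: super_hom_br.
Qed.

Lemma image_lower_central A n :
  f @` lower_central A n = lower_central (f @` A) n.
Proof. by elim: n => //= n IHn; rewrite image_brs IHn. Qed.

Lemma image_derived A n : f @` derived A n = derived (f @` A) n.
Proof. by elim: n => //= n IHn; rewrite image_brs IHn. Qed.

Lemma super_hom_iter_br n x y : f (iter n (br x) y) = iter n (br (f x)) (f y).
Proof. by elim: n => //= n IHn; rewrite (super_hom_br fh) IHn. Qed.

Lemma n_engel_range n : n_engel n [set: L] -> n_engel n (range f).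
Proof.
move=> eL _ _ [x _ <-] [y _ <-].
by rewrite -super_hom_iter_br eL // (lin0 fl).
Qed.

Lemma lower_central_range n :
  lower_central [set: L] n = [set 0] -> lower_central (range f) n = [set 0].
Proof. by move=> L0; rewrite -image_lower_central L0 image_set0. Qed.

Lemma derived_range n :
  derived [set: L] n = [set 0] -> derived (range f) n = [set 0].
Proof. by move=> L0; rewrite -image_derived L0 image_set0. Qed.

Lemma brs_eq0 (A B : set L) :
  (forall x y, A x -> B y -> br x y = 0) -> brs A B = [set 0].
Proof.
move=> AB0; apply/seteqP; split.
  apply: smallest_sub; first by split=> [|k x y -> ->]; rewrite ?scaler0 ?addr0.
  by move=> _ [x Ax [y By <-]]; exact: AB0.
by move=> _ ->; apply: submod0; exact: submod_smallest.
Qed.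

Hypothesis f_central : forall x y, f x = 0 -> br x y = 0.

(** A set with zero image lies in the central kernel. Taking for [A] the [n]-th term of either
    series, whose image is the [n]-th term for [range f], this kills the next term in [L]. *)
Lemma brs_image0 (A B : set L) : f @` A = [set 0] -> brs A B = [set 0].
Proof.
move=> A0; apply: brs_eq0 => x y Ax _; apply: f_central.
by suff : [set 0] (f x) by []; rewrite -A0; exists x.
Qed.

Lemma lower_central_extension n :
  lower_central (range f) n = [set 0] -> lower_central [set: L] n.+1 = [set 0].
Proof. by rewrite -image_lower_central; exact: brs_image0. Qed.

Lemma derived_extension n :
  derived (range f) n = [set 0] -> derived [set: L] n.+1 = [set 0].
Proof. by rewrite -image_derived; exact: brs_image0. Qed.

(** Skew-symmetry moves the kernel element to the left, but it is available for homogeneous elements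
    only, so both arguments are split into components. *)
Lemma br_ker_r x z : f z = 0 -> br x z = 0.
Proof.
have [x0 [x1 [hx0 hx1 ->]]] := grade_decomp x.
have [z0 [z1 [hz0 hz1 ->]]] := grade_decomp z.
(* Since [f] is even and [f z0 = - f z1], the element [f z0] is both even and odd: the kernel is
   graded. *)
rewrite (linD fl) => fz; have fz0 : f z0 = 0.
  apply: grade_indep; first exact: (super_hom_even fh).
  rewrite -[f z0](addrK (f z1)) fz sub0r.
  by apply: gradeN; exact: (super_hom_even fh).
have fz1 : f z1 = 0 by move: fz; rewrite fz0 add0r.
rewrite (linD (br_linearl _)) !(linD (br_linearr _)).
rewrite (br_skew _ _ _ _ hx0 hz0) (br_skew _ _ _ _ hx0 hz1).
rewrite (br_skew _ _ _ _ hx1 hz0) (br_skew _ _ _ _ hx1 hz1).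
by rewrite !f_central // !scaler0 !oppr0 !addr0.
Qed.

(** After [n] brackets with [x] the result lies in the kernel of [f]; one more bracket kills it. *)
Lemma n_engel_extension n : n_engel n (range f) -> n_engel n.+1 [set: L].
Proof.
move=> eL x y _ _; rewrite iterS; apply: br_ker_r.
by rewrite super_hom_iter_br eL //; exact: imageT.
Qed.

End SuperHomomorphism.

(** * Nilpotency class and derived length as least indices *)

Section Least.
Local Open Scope nat_scope.
Variable P : nat -> Prop.
Let least := xget 0 [set n | P n /\ forall k, P k -> n <= k].

(** A witness of [P] yields a minimal one, so [xget] does not fall back on its default value 0. *)
Lemma least_spec n : P n -> P least /\ least <= n.
Proof.
move=> Pn; suff [m m_min] : exists m, P m /\ forall k, P k -> m <= k.
  have [Pl l_min] : [set n | P n /\ forall k, P k -> n <= k] least.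
    exact: xgetI m_min.
  split; [exact: Pl|exact: l_min].
have exP : exists k, `[< P k >] by exists n; apply/asboolP.
case: (ex_minnP exP) => m /asboolP Pm m_min; exists m; split=> // k Pk.
exact/m_min/asboolP.
Qed.

End Least.

Section ClassAndLength.
Variables (K : comPzRingType) (L : lieSuperalgType K) (A : set L).

Lemma nil_class_spec n : lower_central A n = [set 0%R] ->
  lower_central A (nil_class A) = [set 0%R] /\ (nil_class A <= n)%N.
Proof. exact: (@least_spec (fun k => lower_central A k = [set 0%R])). Qed.

Lemma derived_length_spec n : derived A n = [set 0%R] ->
  derived A (derived_length A) = [set 0%R] /\ (derived_length A <= n)%N.
Proof. exact: (@least_spec (fun k => derived A k = [set 0%R])). Qed.

End ClassAndLength.

(** * Homogeneous components *)

Section Projection.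
Import GRing.Theory.
Local Open Scope ring_scope.
Variables (K : comPzRingType) (V : supermodType K).

(** The grading only asserts that components exist, so they are picked by choice; [hproj_uniq] makes
    the choice harmless. *)
Definition hproj_pair (x : V) : V * V :=
  let: exist x0 h := cid (grade_decomp x) in (x0, projT1 (cid h)).

Definition hproj (a : bool) (x : V) : V :=
  if a then (hproj_pair x).2 else (hproj_pair x).1.

Lemma hproj_grade a x : grade a (hproj a x).
Proof.
rewrite /hproj /hproj_pair; case: cid => x0 h; case: cid => x1 [h0 h1 _] /=.
by case: a.
Qed.

Lemma hprojE x : x = hproj false x + hproj true x.
Proof.
by rewrite /hproj /hproj_pair; case: cid => x0 h; case: cid => x1 [].
Qed.

(** The difference of two even components equals a difference of odd ones, hence vanishes by
    independence of the grading. *)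
Lemma hproj_uniq x x0 x1 : grade false x0 -> grade true x1 -> x = x0 + x1 ->
  hproj false x = x0 /\ hproj true x = x1.
Proof.
move=> h0 h1; rewrite [in LHS](hprojE x) => e.
have e' : hproj false x - x0 = x1 - hproj true x.
  by apply/eqP; rewrite subr_eq addrAC eq_sym subr_eq addrC -e addrC.
have gB a y z : grade a y -> grade a z -> grade a (y - z).
  by move=> hy hz; apply: gradeD => //; exact: gradeN.
have d0 : hproj false x - x0 = 0.
  apply: grade_indep; first by apply: gB => //; exact: hproj_grade.
  by rewrite e'; apply: gB => //; exact: hproj_grade.
split; first exact/subr0_eq.
by apply/esym/subr0_eq; rewrite -e'.
Qed.

Lemma hproj_linear a : linear (hproj a).
Proof.
move=> k x y.
have g b : grade b (k *: hproj b x + hproj b y).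
  by apply: (grade_submod b).2; exact: hproj_grade.
have [e0 e1] : hproj false (k *: x + y) = k *: hproj false x + hproj false y /\
               hproj true (k *: x + y) = k *: hproj true x + hproj true y.
  apply: hproj_uniq => //.
  by rewrite [in LHS](hprojE x) [in LHS](hprojE y) scalerDr addrACA.
by case: a.
Qed.

Lemma hproj_homog a b x : grade a x -> hproj b x = if a == b then x else 0.
Proof.
move=> hx.
case: a hx => hx.
  have [] := hproj_uniq (grade0 V false) hx (esym (add0r x)); by case: b.
have [] := hproj_uniq hx (grade0 V true) (esym (addr0 x)); by case: b.
Qed.

End Projection.

(** * The bracket of the tensor product and the kernel of [mu] *)

Section TensorBracket.
Import GRing.Theory.
Local Open Scope ring_scope.
Variables (K : comPzRingType) (M N : lieSuperalgType K).
Variables (aMN : super_action M N) (aNM : super_action N M).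
Hypothesis hc : compatible aMN aNM.
Local Notation T := (tensor aMN aNM).
Local Notation tens := (tens aMN aNM).
Local Notation epiT := (epi (@tsym_deg K M N) (tensor_rel aMN aNM)).

Lemma tensor_relE s t : tensor_rel aMN aNM s t -> epiT s = epiT t.
Proof.
move=> r; have [a [hs ht]] := tensor_rel_deg r.
by apply/epiP; exact: econg_rel hs ht r.
Qed.

(** A symbol carries proofs of homogeneity; proof irrelevance makes it depend only on its degrees
    and elements. *)
Lemma tens_eq a b m m' n n' (hm : grade a m) (hm' : grade a m')
    (hn : grade b n) (hn' : grade b n') :
  m = m' -> n = n' -> tens hm hn = tens hm' hn'.
Proof.
move=> em en; subst m' n'.
by rewrite (Prop_irrelevance hm hm') (Prop_irrelevance hn hn').
Qed.

Lemma tensDl a b m m' n (hm : grade a m) (hm' : grade a m') (hn : grade b n)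
    (hmm' : grade a (m + m')) :
  tens hmm' hn = tens hm hn + tens hm' hn.
Proof. by rewrite /Defs.tens -epiDE; apply: tensor_relE; exact: tensor_addl. Qed.

Lemma tensDr a b m n n' (hm : grade a m) (hn : grade b n) (hn' : grade b n')
    (hnn' : grade b (n + n')) :
  tens hm hnn' = tens hm hn + tens hm hn'.
Proof. by rewrite /Defs.tens -epiDE; apply: tensor_relE; exact: tensor_addr. Qed.

Lemma tensZl a b k m n (hm : grade a m) (hn : grade b n)
    (hkm : grade a (k *: m)) :
  tens hkm hn = k *: tens hm hn.
Proof. by rewrite /Defs.tens -epiZE; apply: esym; apply: tensor_relE; exact: tensor_scalel. Qed.

Lemma tensZr a b k m n (hm : grade a m) (hn : grade b n)
    (hkn : grade b (k *: n)) :
  tens hm hkn = k *: tens hm hn.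
Proof. by rewrite /Defs.tens -epiZE; apply: esym; apply: tensor_relE; exact: tensor_scaler. Qed.

Lemma br_tens a a' b b' m m' n n' (hm : grade a m) (hm' : grade a' m')
    (hn : grade b n) (hn' : grade b' n') :
  br (tens hm hn) (tens hm' hn') =
    - ((-1) ^+ (a * b)%N *:
       tens (act_grade aNM hn hm) (act_grade aMN hm' hn')).
Proof.
rewrite /Defs.tens -epiZE -epiNE -[LHS]/(pbr _ _) -epi_br.
apply: tensor_relE; exact: tensor_br.
Qed.

(** Projecting first gives a function defined on all pairs, free of proof arguments, so that
    bilinearity can be stated. *)
Definition htens (a b : bool) (m : M) (n : N) : T :=
  tens (hproj_grade a m) (hproj_grade b n).

Lemma htens_linearl a b n : linear ((htens a b)^~ n).
Proof.
move=> k x y; rewrite /htens.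
have hk : grade a (k *: hproj a x) by apply: gradeZ; exact: hproj_grade.
have hky : grade a (k *: hproj a x + hproj a y).
  by apply: gradeD => //; exact: hproj_grade.
rewrite -(tensZl _ _ hk) -(tensDl _ _ _ hky).
by apply: tens_eq => //; exact: hproj_linear.
Qed.

Lemma htens_linearr a b m : linear (htens a b m).
Proof.
move=> k x y; rewrite /htens.
have hk : grade b (k *: hproj b x) by apply: gradeZ; exact: hproj_grade.
have hky : grade b (k *: hproj b x + hproj b y).
  by apply: gradeD => //; exact: hproj_grade.
rewrite -(tensZr _ _ hk) -(tensDr _ _ _ hky).
by apply: tens_eq => //; exact: hproj_linear.
Qed.

Lemma htens_homog a b c d m n (hm : grade a m) (hn : grade b n) :
  htens c d m n = if (a == c) && (b == d) then tens hm hn else 0.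
Proof.
have [<-|nac] /= := eqVneq a c; last first.
  (* The vanishing component is written with a factor 0, which relation (i) pulls out of the
     symbol. *)
  have gm : grade c (0 *: hproj c m) by apply: gradeZ; exact: hproj_grade.
  rewrite -[RHS](scale0r (htens c d m n)) -(tensZl _ _ gm); apply: tens_eq => //.
  by rewrite (hproj_homog _ hm) (negPf nac) scaler0.
have [<-|nbd] /= := eqVneq b d; last first.
  have gn : grade d (0 *: hproj d n) by apply: gradeZ; exact: hproj_grade.
  rewrite -[RHS](scale0r (htens a d m n)) -(tensZr _ _ gn); apply: tens_eq => //.
  by rewrite (hproj_homog _ hn) (negPf nbd) scaler0.
by apply: tens_eq; [rewrite (hproj_homog _ hm) eqxx|rewrite (hproj_homog _ hn) eqxx].
Qed.

(* Bilinear extension of [tens], which only takes homogeneous arguments, to all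
   of [M] and [N]. *)
Definition ltens (m : M) (n : N) : T :=
  \sum_(a : bool) \sum_(b : bool) htens a b m n.

Lemma ltens_linearl n : linear (ltens^~ n).
Proof.
move=> k x y; rewrite /ltens scaler_sumr -big_split; apply: eq_bigr => a _ /=.
rewrite scaler_sumr -big_split; apply: eq_bigr => b _.
exact: htens_linearl.
Qed.

Lemma ltens_linearr m : linear (ltens m).
Proof.
move=> k x y; rewrite /ltens scaler_sumr -big_split; apply: eq_bigr => a _ /=.
rewrite scaler_sumr -big_split; apply: eq_bigr => b _.
exact: htens_linearr.
Qed.

Lemma ltens_tens a b m n (hm : grade a m) (hn : grade b n) :
  ltens m n = tens hm hn.
Proof.
rewrite /ltens !big_bool /= !(htens_homog _ _ hm hn).
by case: a b hm hn => [] [] hm hn /=; rewrite ?addr0 ?add0r.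
Qed.

(** The symbols span the tensor product as a module, not just as a Lie superalgebra. As [P] need not
    be closed under brackets, the induction on expressions is run on the span [S] of the symbols. *)
Lemma tensor_ind (P : set T) : submod P ->
  (forall a b m n (hm : grade a m) (hn : grade b n), P (tens hm hn)) ->
  forall x, P x.
Proof.
move=> sP Pt x; have [s ->] := epi_surj x => {x}.
pose S := smallest (@submod K T)
  [set x | exists a b m n (hm : grade a m) (hn : grade b n), x = tens hm hn].
have sS : submod S by exact: submod_smallest.
have St a b m n (hm : grade a m) (hn : grade b n) : S (tens hm hn).
  by move=> B [_ GB]; apply: GB; exists a, b, m, n, hm, hn.
have SP : S `<=` P.
  by apply: smallest_sub => // _ [a [b [m [n [hm [hn ->]]]]]].
(* Bilinearity reduces each argument to a symbol, and by relation (iv) the bracket of two symbols is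
   a multiple of a symbol. *)
have Sbr x y : S x -> S y -> S (br x y).
  move=> Sx Sy.
  apply: (Sx (br^~ y @^-1` S)); split.
    by apply: submod_preimage => //; exact: br_linearl.
  move=> _ [a [b [m [n [hm [hn ->]]]]]] /=.
  apply: (Sy (br (tens hm hn) @^-1` S)); split.
    by apply: submod_preimage => //; exact: br_linearr.
  move=> _ [a' [b' [m' [n' [hm' [hn' ->]]]]]] /=.
  by rewrite br_tens; apply: (submodN sS); apply: (submodZ sS); exact: St.
apply: SP; elim: s => [[a b m n hm hn]||s IHs t IHt|s IHs|k s IHs|s IHs t IHt].
- exact: St.
- exact: (submod0 sS).
- by rewrite epiDE; exact: (submodD sS).
- by rewrite epiNE; exact: (submodN sS).
- by rewrite epiZE; exact: (submodZ sS).
- by rewrite epi_br; exact: Sbr.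
Qed.

(** Both sides are bilinear, so it suffices to compare them on symbols. There relation (iv) applies,
    its sign being exactly the one in [mu]. *)
Lemma br_tensorE (x y : T) : br x y = ltens (mu aMN aNM x) (nu aMN aNM y).
Proof.
have mul := super_hom_linear (mu_hom hc); have nul := super_hom_linear (nu_hom hc).
move: x; apply: tensor_ind.
  split=> [|k x x' /= ex ex'].
    by rewrite /= (lin0 mul) (lin0 (br_linearl _)) (lin0 (ltens_linearl _)).
  by rewrite mul (br_linearl y) (ltens_linearl _) ex ex'.
move=> a b m n hm hn /=; move: y; apply: tensor_ind.
  split=> [|k y y' /= ey ey'].
    by rewrite /= (lin0 nul) (lin0 (br_linearr _)) (lin0 (ltens_linearr _)).
  by rewrite nul (br_linearr (tens hm hn)) (ltens_linearr _) ey ey'.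
move=> a' b' m' n' hm' hn' /=.
rewrite br_tens (mu_tens hc) (nu_tens hc) (linN (ltens_linearl _)).
by rewrite (linZ (ltens_linearl _)) -ltens_tens.
Qed.

Lemma mu_central (x y : T) : mu aMN aNM x = 0 -> br x y = 0.
Proof. by rewrite br_tensorE => ->; exact: lin0 (ltens_linearl _). Qed.

End TensorBracket.

(** * Transfer along the central extension [mu] and the quotient map [nu] *)

Theorem theorem3p9 (K : comPzRingType) (M N : lieSuperalgType K)
    (aMN : super_action M N) (aNM : super_action N M)
    (hc : compatible aMN aNM) :
  let T : set (tensor aMN aNM) := [set: tensor aMN aNM] in
  let IM : set M := range (mu aMN aNM) in
  let IN : set N := range (nu aMN aNM) in
  [/\ (nilpotent IM ->
        [/\ nilpotent T, nilpotent IN,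
            (nil_class IM <= nil_class T <= (nil_class IM).+1)%N
          & (nil_class IN <= (nil_class IM).+1)%N]),
      (solvable IM ->
        [/\ solvable T, solvable IN,
            (derived_length IM <= derived_length T <= (derived_length IM).+1)%N
          & (derived_length IN <= (derived_length IM).+1)%N]),
      (engel IM -> engel T /\ engel IN)
    & (forall n : nat, n_engel n IM -> n_engel n.+1 T /\ n_engel n.+1 IN)].
Proof.
move=> T IM IN.
have muh := mu_hom hc; have nuh := nu_hom hc.
have central := mu_central hc.
have eng n : n_engel n IM -> n_engel n.+1 T /\ n_engel n.+1 IN.
  move=> eIM; have eT := n_engel_extension muh central eIM.
  by split=> //; exact: n_engel_range nuh _ eT.
split=> //.
(* The given index is replaced by the class itself, so that the extension step yields the sharp
   bound. *)
- move=> [n /nil_class_spec[cM _]].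
  have T0 := lower_central_extension muh central cM.
  have N0 := lower_central_range nuh T0.
  have [cT le_T] := nil_class_spec T0; have [_ le_N] := nil_class_spec N0.
  (* The lower bound goes the other way: the series of the image under [mu] vanishes at the class of
     [T]. *)
  have [_ le_M] := nil_class_spec (lower_central_range muh cT).
  by split; [eexists; exact: T0|eexists; exact: N0|exact/andP|].
- move=> [n /derived_length_spec[cM _]].
  have T0 := derived_extension muh central cM.
  have N0 := derived_range nuh T0.
  have [cT le_T] := derived_length_spec T0; have [_ le_N] := derived_length_spec N0.
  have [_ le_M] := derived_length_spec (derived_range muh cT).
  by split; [eexists; exact: T0|eexists; exact: N0|exact/andP|].
- by move=> [n /eng[eT eN]]; split; exists n.+1.
Qed.
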